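(* Let $\Gamma$ be a compact metric graph and $d\ge0$. Every tropically convex subset $T\subseteq\mathrm{Div}^d_{+,\mathbb R}(\Gamma)$ is contractible (in the topology induced by the metric $\rho$).
   Context: $\Gamma$ is a compact metric graph (finitely many edges of finite length). An $\mathbb R$-divisor is a finite formal sum $\sum_p m_p(p)$, $m_p\in\mathbb R$, $p\in\Gamma$; effective means all $m_p\ge0$; degree is $\sum m_p$. $\mathrm{Div}^d_{+,\mathbb R}(\Gamma)$ is the set of effective $\mathbb R$-divisors of degree $d$. For a continuous piecewise-linear $f$ on $\Gamma$, $\Delta f=\sum_p\sigma_p(f)(p)$ where $-\sigma_p(f)$ is the sum of the outgoing slopes of $f$ at $p$. For effective $D_1,D_2$ of equal degree, $f_{D_2-D_1}$ denotes a continuous piecewise-linear function with $\Delta f_{D_2-D_1}=D_2-D_1$ (unique up to additive constant). The metric is $\rho(D_1,D_2)=\max f_{D_2-D_1}-\min f_{D_2-D_1}$. The tropical segment $\mathrm{tconv}(D_1,D_2)$ is the image of $t\mapsto D_1+\Delta\min(t\rho(D_1,D_2),f_{D_2-D_1}-\min f_{D_2-D_1})$, $t\in[0,1]$. $T$ is tropically convex if $\mathrm{tconv}(D_1,D_2)\subseteq T$ whenever $D_1,D_2\in T$. *)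

(* Defs.v *)
From HB Require Import structures.
From mathcomp Require Import all_boot all_order all_algebra finmap.
From mathcomp Require Import mathcomp_extra boolp classical_sets functions.
From mathcomp Require Import reals topology normedtype numfun realfun.

Set Implicit Arguments.
Unset Strict Implicit.
Unset Printing Implicit Defensive.

Import Order.TTheory GRing.Theory Num.Theory.
Import numFieldNormedType.Exports.

Local Open Scope classical_set_scope.
Local Open Scope ring_scope.

(* A compact metric graph, presented by a model: finitely many vertices and
   edges, loops and multiple edges allowed. Metric graphs are connected; this
   is what makes f_{D2 - D1} below exist and be unique up to a constant.
   The orientation src -> tgt only serves to parametrise each edge. *)
Record metricGraph (R : realType) := MetricGraph {
  vertex : finType;
  edge : finType;
  src : edge -> vertex;
  tgt : edge -> vertex;
  len : edge -> R;
  len_gt0 : forall e, 0 < len e;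
  graph_connected : forall u v,
    connect (fun a b => [exists e,
      ((src e == a) && (tgt e == b)) || ((src e == b) && (tgt e == a))]) u v }.

Section MetricGraphs.
Context {R : realType} (G : metricGraph R).

(* A point of the graph is a vertex, or an interior point of an edge e, given
   by e and its distance x from src e along e, 0 < x < len e. *)
Definition gpoint : Type :=
  (vertex G + {y : edge G * R | 0 < y.2 < len y.1})%type.
HB.instance Definition _ := Choice.on gpoint.

(* The parametrisation of the closed edge e by [0, len e]. *)
Definition edge_pt (e : edge G) (x : R) : gpoint :=
  if insub (e, x) is Some y then inr y
  else if x <= 0 then inl (src e) else inl (tgt e).

(* The pieces are closed and cover [a, b], so continuity is built in. *)
Definition piecewise_linear_on (a b : R) (g : R -> R) :=
  exists2 s : seq R, itv_partition a b s &
    forall i, (i < size s)%N -> exists k c : R,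
      forall x, nth b (a :: s) i <= x <= nth b s i -> g x = k * x + c.

Definition piecewise_linear (f : gpoint -> R) :=
  forall e, piecewise_linear_on 0 (len e) (f \o edge_pt e).

(* Slope of g at x in the direction s = 1 or s = -1. *)
Definition dir_slope (g : R -> R) (x s : R) : R :=
  lim ((fun h => (g (x + s * h) - g x) / h) @ 0^'+).

(* A loop at v contributes two outgoing directions, one in each sum. *)
Definition outgoing_slopes (f : gpoint -> R) (p : gpoint) : R :=
  match p with
  | inl v =>
      \sum_(e | src e == v) dir_slope (f \o edge_pt e) 0 1 +
      \sum_(e | tgt e == v) dir_slope (f \o edge_pt e) (len e) (-1)
  | inr y =>
      let: (e, x) := val y in
      dir_slope (f \o edge_pt e) x 1 + dir_slope (f \o edge_pt e) x (-1)
  end.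

Definition laplacian (f : gpoint -> R) (p : gpoint) : R := - outgoing_slopes f p.

Local Notation divisor := {fsfun gpoint -> R with 0}.

Definition degree (D : divisor) : R := \sum_(p <- finsupp D) D p.

Definition effective (D : divisor) := forall p, 0 <= D p.

Record effDivisor (d : R) := EffDivisor {
  effDivisor_val :> divisor;
  effDivisor_effective : effective effDivisor_val;
  effDivisor_degree : degree effDivisor_val = d }.

HB.instance Definition _ (d : R) := gen_eqMixin (effDivisor d).
HB.instance Definition _ (d : R) := gen_choiceMixin (effDivisor d).

Section Degree.
Context {d : R}.
Implicit Types (D : effDivisor d) (T : set (effDivisor d)).

(* f_{D2 - D1}: some representative, the additive constant being irrelevant
   below. *)
Definition potential D1 D2 : gpoint -> R :=
  xget (fun=> 0) [set f | piecewise_linear f /\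
                          forall p, laplacian f p = D2 p - D1 p].

Definition rho D1 D2 : R :=
  sup (range (potential D1 D2)) - inf (range (potential D1 D2)).

Definition tpath D1 D2 (t : R) (p : gpoint) : R :=
  D1 p + laplacian (fun q => Num.min (t * rho D1 D2)
    (potential D1 D2 q - inf (range (potential D1 D2)))) p.

Definition tconv D1 D2 : set (gpoint -> R) := tpath D1 D2 @` `[0, 1].

Definition tropically_convex T := forall D1 D2, T D1 -> T D2 ->
  tconv D1 D2 `<=` [set (D : gpoint -> R) | D in T].

(* The topology of the metric rho. *)
Definition rho_open (U : set (effDivisor d)) := forall D, U D ->
  exists2 e : R, 0 < e & forall D', rho D D' < e -> U D'.

Let rho_openT : rho_open setT.
Proof. by move=> D _; exists 1. Qed.

Let rho_openI : setI_closed rho_open.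
Proof.
move=> U V oU oV D [/oU[e e0 eU] /oV[e' e'0 eV]].
exists (Num.min e e'); first by rewrite lt_min e0.
by move=> D'; rewrite lt_min => /andP[/eU ? /eV].
Qed.

Let rho_open_bigU (I : Type) (U : I -> set (effDivisor d)) :
  (forall i, rho_open (U i)) -> rho_open (\bigcup_i U i).
Proof.
move=> oU D [i _ /oU[e e0 eU]]; exists e => // D' /eU UD'.
by exists i.
Qed.

HB.instance Definition _ := isOpenTopological.Build (effDivisor d)
  rho_openT rho_openI rho_open_bigU.

End Degree.
End MetricGraphs.

(* The subspace A of X is contractible: its identity map is homotopic to a
   constant map. In particular A is nonempty. *)
Definition contractible (R : realType) (X : topologicalType) (A : set X) :=
  exists2 a : X, A a & exists H : R * X -> X,
    [/\ {within `[0, 1] `*` A, continuous H},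
        forall (t : R) x, 0 <= t <= 1 -> A x -> A (H (t, x)),
        forall x, A x -> H (0, x) = x &
        forall x, A x -> H (1, x) = a].

(* Main.v *)
From HB Require Import structures.
Require Import Defs.
From mathcomp Require Import all_boot all_order all_algebra finmap.
From mathcomp Require Import boolp classical_sets.
From mathcomp Require Import reals topology normedtype numfun.
From mathcomp Require Import ring lra.

Set Implicit Arguments.
Unset Strict Implicit.
Unset Printing Implicit Defensive.

Import Order.TTheory GRing.Theory Num.Theory.
Import numFieldNormedType.Exports.

Local Open Scope classical_set_scope.
Local Open Scope ring_scope.

(** Contract [T] onto one of its points [E] along the tropical segments: send
    [(t, D)] to the point [D + Δ min(t ρ(D,E), u_D)], with [u_D] the potential
    [f_(E - D)] shifted to have infimum 0. Since [ρ] is the oscillation of a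
    potential and potentials are additive up to constants, replacing [D] by
    [D'] changes [u_D] uniformly, and [ρ(D,E)], by at most [ρ(D,D')]; as [min]
    is 1-Lipschitz, the homotopy is continuous.

    This needs the potentials to exist and to be unique up to constants.
    A tent function on one edge moves a unit mass from an interior point to the
    two end points, which reduces the Poisson equation to a vertex-supported
    right-hand side, where it is the weighted Laplacian of a finite connected
    graph. Conversely a harmonic function is affine on each edge, and its vertex
    values lie in the kernel of the same finite Laplacian, by an energy argument
    the constants. *)

(** * Piecewise linear functions on an interval *)

Section Germs.
Context {R : realType}.
Implicit Types (g : R -> R) (a b c x s k : R).

(** * One-sided slopes and their arithmetic *)

(** Exact affineness on a short one-sided interval replaces the limit in [dir_slope], so that slopes
    combine by plain algebra. The slope is taken per unit of [h], hence [k] is an outgoing slope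
    also for [s = -1]. *)
Definition has_slope g x s k :=
  exists2 e : R, 0 < e & forall h : R, 0 <= h <= e -> g (x + s * h) = g x + k * h.

Lemma has_slope_dir_slope g x s k : has_slope g x s k -> dir_slope g x s = k.
Proof.
move=> [e e0 ge]; apply/cvg_lim => //.
apply: (@cvg_trans _ ((fun=> k) @ (0 : R)^'+)); last exact: cvg_cst.
apply: near_eq_cvg; near=> h.
have h0 : 0 < h by near: h; exact: nbhs_right_gt.
have he : h <= e by near: h; exact: nbhs_right_le.
by rewrite ge ?he ?(ltW h0)// addrC addKr mulfK// gt_eqF.
Unshelve. all: by end_near. Qed.

Lemma has_slope_eq g1 g2 x s k : (exists2 e : R, 0 < e &
    forall h : R, 0 <= h <= e -> g1 (x + s * h) = g2 (x + s * h)) ->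
  has_slope g2 x s k -> has_slope g1 x s k.
Proof.
move=> [e e0 eg] [e' e'0 g2k]; exists (Num.min e e').
  by rewrite lt_min e0.
move=> h; rewrite le_min => /and3P[h0 he he'].
have := eg 0; rewrite mulr0 addr0 => ->; last by rewrite lexx ltW.
by rewrite eg ?h0// g2k ?h0.
Qed.

Lemma has_slope_affine g k c x s :
  (exists2 e : R, 0 < e & forall h : R, 0 <= h <= e ->
    g (x + s * h) = k * (x + s * h) + c) -> has_slope g x s (s * k).
Proof.
move=> H; apply: (has_slope_eq (g2 := fun y => k * y + c) H); exists 1 => // h _; ring.
Qed.

Lemma has_slope_cst c x s : has_slope (fun=> c) x s 0.
Proof. by exists 1 => // h _; rewrite mul0r addr0. Qed.

Lemma has_slopeD g1 g2 x s k1 k2 : has_slope g1 x s k1 ->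
  has_slope g2 x s k2 -> has_slope (fun y => g1 y + g2 y) x s (k1 + k2).
Proof.
move=> [e e0 gk] [e' e'0 gk']; exists (Num.min e e').
  by rewrite lt_min e0.
move=> h; rewrite le_min => /and3P[h0 he he'].
by rewrite gk ?h0// gk' ?h0//; ring.
Qed.

Lemma has_slopeZ g x s k c :
  has_slope g x s k -> has_slope (fun y => c * g y) x s (c * k).
Proof. by move=> [e e0 gk]; exists e => // h /gk ->; ring. Qed.

(** Near [x] the function with the smaller value at [x] realises the minimum and, in case of a tie,
    the one with the smaller outgoing slope. *)
Lemma has_slope_min g1 g2 x s k1 k2 : has_slope g1 x s k1 ->
  has_slope g2 x s k2 ->
  exists k, has_slope (fun y => Num.min (g1 y) (g2 y)) x s k.
Proof.
wlog : g1 g2 k1 k2 / g1 x < g2 x \/ g1 x = g2 x /\ k1 <= k2.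
  move=> wl H1 H2.
  have sw : (exists k, has_slope (fun y => Num.min (g2 y) (g1 y)) x s k) ->
      exists k, has_slope (fun y => Num.min (g1 y) (g2 y)) x s k.
    move=> [k Hk]; exists k; apply: has_slope_eq Hk.
    by exists 1 => // h _; rewrite minC.
  have [l12|l21|e12] := ltgtP (g1 x) (g2 x).
  - by apply: wl H1 H2; left.
  - by apply/sw; apply: wl H2 H1; left.
  - have [k12|k21] := leP k1 k2.
      by apply: wl H1 H2; right.
    by apply/sw; apply: wl H2 H1; right; split=> //; exact: ltW.
move=> H12 [e1 e10 gk1] [e2 e20 gk2]; exists k1.
have [e e0 le12] : exists2 e : R, 0 < e &
    forall h : R, 0 <= h <= e -> g1 x + k1 * h <= g2 x + k2 * h.
  case: H12 => [l12|[e12 k12]]; last first.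
    by exists 1 => // h /andP[h0 _]; rewrite e12 lerD2l ler_wpM2r.
  have A0 : 0 < `|k1 - k2| + 1 by rewrite ltr_wpDl.
  (* The gap shrinks at rate at most [|k1 - k2|]; the added 1 keeps the denominator positive. *)
  exists ((g2 x - g1 x) / (`|k1 - k2| + 1)); first by rewrite divr_gt0 ?subr_gt0.
  move=> h /andP[h0]; rewrite ler_pdivlMr// => hA.
  have : (k1 - k2) * h <= h * (`|k1 - k2| + 1).
    rewrite mulrC ler_wpM2l// (le_trans (ler_norm _))// lerDl//.
  by lra.
exists (Num.min e (Num.min e1 e2)); first by rewrite !lt_min e0 e10.
move=> h; rewrite !le_min => /and4P[h0 he he1 he2].
rewrite gk1 ?h0// gk2 ?h0// min_l ?le12 ?h0//; congr (_ + _).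
by rewrite min_l//; case: H12 => [/ltW//|[->]].
Qed.

(* Piecewise linearity as a local condition, which is stable under sums and
   minima without any common refinement of partitions. *)
Definition pl_germs a b g :=
  (forall x, a <= x < b -> exists k, has_slope g x 1 k) /\
  (forall x, a < x <= b -> exists k, has_slope g x (-1) k).

(** * From local to global piecewise linearity *)

(** The supremum of the points of [[a, b]] satisfying [S] satisfies [S] itself by the left-hand
    hypothesis, and the right-hand one would push past it if it were below [b]. *)
Lemma real_induction (S : set R) a b : a <= b -> S a ->
  (forall x, a <= x < b -> S x -> exists2 y, x < y <= b & S y) ->
  (forall x, a < x <= b -> exists2 e : R, 0 < e &
     forall y, a <= y -> x - e < y < x -> S y -> S x) ->
  S b.
Proof.
move=> ab Sa Sr Sl; pose A := [set x | a <= x <= b /\ S x].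
have Aa : A a by split=> //; rewrite lexx.
have supA : has_sup A.
  by split; [exists a | exists b => x [/andP[]]].
have ac : a <= sup A by exact: ub_le_sup supA.2 _ Aa.
have cb : sup A <= b by apply: ge_sup supA.1 _ => x [/andP[]].
have Sc : S (sup A).
  have [->//|neq] := eqVneq (sup A) a.
  have [|e e0 He] := Sl (sup A); first by rewrite lt_neqAle eq_sym neq ac.
  have [y [/andP[ay yb] Sy] ltey] := sup_adherent e0 supA.
  have : y <= sup A by apply: ub_le_sup supA.2 _ _; split=> //; rewrite ay.
  rewrite le_eqVlt => /predU1P[<-//|yc].
  by apply: He Sy => //; rewrite ltey.
move: cb; rewrite le_eqVlt => /predU1P[<-//|cb].
have [|y /andP[cy yb] Sy] := Sr _ _ Sc; first by rewrite ac.
have : y <= sup A.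
  by apply: ub_le_sup supA.2 _ _; split=> //; rewrite yb (le_trans ac (ltW cy)).
by rewrite leNgt cy.
Qed.

(** Peeling off the first affine piece turns an induction on partitions into one on the left end
    point. *)
Lemma piecewise_linear_on_ind (P : R -> Prop) b g :
  P b ->
  (forall a c k d, a < c <= b ->
     (forall x, a <= x <= c -> g x = k * x + d) -> P c -> P a) ->
  forall a, piecewise_linear_on a b g -> P a.
Proof.
move=> Pb PS a [s]; elim: s a => [|c s IH] a; first by move=> /itv_partition_nil ->.
move=> abs aff; have [/= /andP[ac ps] ls] := abs.
have cbs : itv_partition c b s by split.
have [k [d kd]] := aff 0%N isT.
apply: (PS a c k d) => //; first by rewrite ac (itv_partition_le cbs).
by apply: IH => // i si; exact: (aff i.+1 si).
Qed.

Lemma piecewise_linear_on_pl_germs a b g :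
  piecewise_linear_on a b g -> pl_germs a b g.
Proof.
move: a; apply: (piecewise_linear_on_ind (P := fun a => pl_germs a b g)).
  by split=> x; move=> /andP[h1 h2]; exfalso; lra.
move=> a c k d /andP[ac cb] aff [Hr Hl]; split=> x /andP[x1 x2].
  have [xc|cx] := ltP x c; last by apply: Hr; rewrite cx.
  exists (1 * k); apply: (has_slope_affine (c := d)).
  exists (c - x); first by rewrite subr_gt0.
  by move=> h /andP[h0 he]; apply: aff; apply/andP; split; lra.
have [xc|cx] := leP x c; last by apply: Hl; rewrite cx.
exists (-1 * k); apply: (has_slope_affine (c := d)).
exists (x - a); first by rewrite subr_gt0.
by move=> h /andP[h0 he]; apply: aff; apply/andP; split; lra.
Qed.

Lemma piecewise_linear_on_bounded a b g : piecewise_linear_on a b g ->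
  exists M, forall x, a <= x <= b -> `|g x| <= M.
Proof.
move: a; apply: (piecewise_linear_on_ind
  (P := fun a => exists M, forall x, a <= x <= b -> `|g x| <= M)).
  by exists `|g b| => x; rewrite -eq_le => /eqP <-.
move=> a c k d /andP[ac cb] aff [M HM].
exists (Num.max M (`|k| * (`|a| + `|c|) + `|d|)) => x /andP[ax xb].
rewrite le_max; have [xc|cx] := leP x c; last by rewrite HM ?(ltW cx).
rewrite aff ?ax//; apply/orP; right.
apply: le_trans (ler_normD _ _) _; rewrite lerD2r normrM ler_wpM2l//.
by rewrite ler_norml; have := ler_norm c; have := ler_norm (- a);
  rewrite normrN; have := normr_ge0 a; have := normr_ge0 c; lra.
Qed.

Lemma piecewise_linear_on_rcons a b c g k d : piecewise_linear_on a c g ->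
  c < b -> (forall x, c <= x <= b -> g x = k * x + d) ->
  piecewise_linear_on a b g.
Proof.
move=> [s [ps /eqP ls] aff] cb kd; exists (rcons s b).
  by split; rewrite ?last_rcons// rcons_path ps ls.
(* Appending [b] keeps the earlier nodes; the default value differs on the two sides but is not
   reached at these indices. *)
have E i : (i <= size s)%N -> nth b (a :: rcons s b) i = nth c (a :: s) i.
  move=> si; rewrite -rcons_cons nth_rcons/= ltnS si.
  by apply: set_nth_default; rewrite /= ltnS.
move=> i; rewrite size_rcons ltnS leq_eqVlt => /predU1P[->|si].
  exists k, d => x; rewrite E// nth_rcons ltnn eqxx.
  by have := nth_last c (a :: s); rewrite /= ls => ->; exact: kd.
have [k' [d' kd']] := aff i si; exists k', d' => x.
rewrite (E i (ltnW si)) nth_rcons si (set_nth_default c)//; exact: kd'.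
Qed.

Lemma has_slope_right_affine g x k : has_slope g x 1 k ->
  exists2 e : R, 0 < e & forall y, x <= y <= x + e -> g y = k * y + (g x - k * x).
Proof.
move=> [e e0 gk]; exists e => // y /andP[xy ye].
have := gk (y - x); rewrite mul1r (addrC x) subrK => ->; first ring.
by apply/andP; split; lra.
Qed.

Lemma has_slope_left_affine g x k : has_slope g x (-1) k ->
  exists2 e : R, 0 < e & forall y, x - e <= y <= x -> g y = - k * y + (g x + k * x).
Proof.
move=> [e e0 gk]; exists e => // y /andP[xy ye].
have := gk (x - y); rewrite (_ : x + -1 * (x - y) = y) => [->|];
  [ring| |by ring].
by apply/andP; split; lra.
Qed.

(** Real induction on the right end point [x]: the right germ at [x] starts a new piece, and the
    left germ at [x] closes a partition that ends shortly before [x]. *)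
Lemma pl_germs_piecewise_linear_on a b g : a <= b -> pl_germs a b g ->
  piecewise_linear_on a b g.
Proof.
move=> ab [Hr Hl].
apply: (@real_induction [set x | piecewise_linear_on a x g] a b ab).
- by exists [::] => //; split=> /=.
- move=> x /andP[ax xb] /= Sx.
  have [|k /has_slope_right_affine[e e0 ke]] := Hr x; first by rewrite ax.
  exists (Num.min b (x + e)).
    by rewrite lt_min xb/= ge_min lexx ltrDl e0.
  apply: (piecewise_linear_on_rcons (k := k) (d := g x - k * x) Sx).
    by rewrite lt_min xb ltrDl.
  by move=> y; rewrite le_min => /and3P[xy yb ye]; apply: ke; rewrite xy.
- move=> x /Hl[k /has_slope_left_affine[e e0 ke]]; exists e => //=.
  move=> y ay /andP[xy yx] Sy.
  apply: (piecewise_linear_on_rcons (k := - k) (d := g x + k * x) Sy) => //.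
  by move=> z /andP[yz zx]; apply: ke; rewrite zx andbT; lra.
Qed.

(** Real induction on how far [g] follows its initial line: at an interior point the absence of a
    bend continues the line, and at a limit point the left germ overlaps it. *)
Lemma pl_germs_affine a b g : a < b -> pl_germs a b g ->
  (forall x, a < x < b -> dir_slope g x 1 + dir_slope g x (-1) = 0) ->
  exists k, forall x, a <= x <= b -> g x = g a + k * (x - a).
Proof.
move=> ab [Hr Hl] H0.
have [|k gk] := Hr a; first by rewrite lexx.
exists k.
apply: (@real_induction
  [set x | forall y, a <= y <= x -> g y = g a + k * (y - a)] a b (ltW ab)).
- by move=> y /=; rewrite -eq_le => /eqP <-; ring.
- move=> x /andP[ax xb] /= Sx.
  have {}gk : has_slope g x 1 k.
    move: ax; rewrite le_eqVlt => /predU1P[<-//|ax].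
    have [|k1 gk1] := Hr x; first by rewrite (ltW ax).
    have [|k2 gk2] := Hl x; first by rewrite (ltW xb) ax.
    have gk2' : has_slope g x (-1) (-1 * k).
      apply: (has_slope_affine (c := g a - k * a)).
      exists (x - a); first by rewrite subr_gt0.
      by move=> h /andP[h0 ha]; rewrite Sx; [ring|apply/andP; split; lra].
    have := H0 x; rewrite ax xb => /(_ isT).
    rewrite (has_slope_dir_slope gk1) (has_slope_dir_slope gk2').
    by move=> k1k; rewrite (_ : k = k1)//; lra.
  have [e e0 ke] := has_slope_right_affine gk.
  exists (Num.min b (x + e)); first by rewrite lt_min xb/= ge_min lexx ltrDl e0.
  move=> y; rewrite le_min => /and3P[ay yb ye].
  have [yx|xy] := leP y x; first by apply: Sx; rewrite ay.
  by rewrite ke ?(ltW xy)// Sx ?lexx ?andbT//; ring.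
- move=> x /andP[ax xb]; have [|k2 gk2] := Hl x; first by rewrite ax.
  have [e e0 ke] := has_slope_left_affine gk2.
  exists (Num.min e (x - a)); first by rewrite lt_min e0 subr_gt0.
  move=> y _ /andP[xy yx] /= Sy.
  have [me ma] : Num.min e (x - a) <= e /\ Num.min e (x - a) <= x - a.
    by rewrite !ge_min !lexx orbT.
  (* A second point, left of [y], where both the initial line and the left germ at [x] describe [g];
     two points determine the slope. *)
  pose z := (y + (x - Num.min e (x - a))) / 2.
  have yz : y - z != 0 by rewrite subr_eq0 gt_eqF// /z; lra.
  have kk2 : - k2 = k.
    have gy : g a + k * (y - a) = - k2 * y + (g x + k2 * x).
      by rewrite -(Sy y) ?(ke y)//; apply/andP; split; lra.
    have gz : g a + k * (z - a) = - k2 * z + (g x + k2 * x).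
      by rewrite -(Sy z) ?(ke z)//; apply/andP; split; rewrite /z; lra.
    by apply: (mulIf yz); rewrite !mulrBr; lra.
  move=> w /andP[aw wx]; have [wy|yw] := leP w y; first by rewrite Sy ?aw.
  rewrite ke; last by apply/andP; split; lra.
  have : g a + k * (y - a) = - k2 * y + (g x + k2 * x).
    by rewrite -(Sy y) ?(ke y)//; apply/andP; split; lra.
  by rewrite -kk2; lra.
Qed.

(** * Closure properties of local piecewise linearity, and tents *)

Lemma has_slope_right_eq a b g1 g2 x k : (forall y, a <= y <= b -> g1 y = g2 y) ->
  a <= x < b -> has_slope g2 x 1 k -> has_slope g1 x 1 k.
Proof.
move=> E /andP[ax xb]; apply: has_slope_eq.
exists (b - x); first by rewrite subr_gt0.
by move=> h /andP[h0 hb]; apply: E; apply/andP; split; lra.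
Qed.

Lemma has_slope_left_eq a b g1 g2 x k : (forall y, a <= y <= b -> g1 y = g2 y) ->
  a < x <= b -> has_slope g2 x (-1) k -> has_slope g1 x (-1) k.
Proof.
move=> E /andP[ax xb]; apply: has_slope_eq.
exists (x - a); first by rewrite subr_gt0.
by move=> h /andP[h0 hb]; apply: E; apply/andP; split; lra.
Qed.

Lemma pl_germs_eq a b g1 g2 : (forall y, a <= y <= b -> g1 y = g2 y) ->
  pl_germs a b g2 -> pl_germs a b g1.
Proof.
move=> E [Hr Hl]; split=> x xab.
  by have [k gk] := Hr x xab; exists k; exact: has_slope_right_eq E xab gk.
by have [k gk] := Hl x xab; exists k; exact: has_slope_left_eq E xab gk.
Qed.

Lemma pl_germsD a b g1 g2 : pl_germs a b g1 -> pl_germs a b g2 ->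
  pl_germs a b (fun y => g1 y + g2 y).
Proof.
move=> [Hr Hl] [Hr' Hl']; split=> x xab.
  have [k gk] := Hr x xab; have [k' gk'] := Hr' x xab.
  by exists (k + k'); exact: has_slopeD.
have [k gk] := Hl x xab; have [k' gk'] := Hl' x xab.
by exists (k + k'); exact: has_slopeD.
Qed.

Lemma pl_germsZ a b g c : pl_germs a b g -> pl_germs a b (fun y => c * g y).
Proof.
move=> [Hr Hl]; split=> x xab.
  by have [k gk] := Hr x xab; exists (c * k); exact: has_slopeZ.
by have [k gk] := Hl x xab; exists (c * k); exact: has_slopeZ.
Qed.

Lemma pl_germs_min a b g1 g2 : pl_germs a b g1 -> pl_germs a b g2 ->
  pl_germs a b (fun y => Num.min (g1 y) (g2 y)).
Proof.
move=> [Hr Hl] [Hr' Hl']; split=> x xab.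
  have [k gk] := Hr x xab; have [k' gk'] := Hr' x xab.
  exact: has_slope_min gk gk'.
have [k gk] := Hl x xab; have [k' gk'] := Hl' x xab.
exact: has_slope_min gk gk'.
Qed.

Lemma pl_germs_affine_fun a b k c : pl_germs a b (fun y => k * y + c).
Proof.
by split=> x _; [exists (1 * k)|exists (-1 * k)];
  apply: has_slope_affine; exists 1.
Qed.

Lemma pl_germs_cst a b c : pl_germs a b (fun=> c).
Proof. by split=> x _; exists 0; exact: has_slope_cst. Qed.

(* The graph of [tent L z] on [0, L] vanishes at the end points and has a
   single break point [z], where the slope drops by 1. *)
Definition tent L z x := Num.min (x * ((L - z) / L)) ((L - x) * (z / L)).

Section Tent.
Context (L z : R) (z0L : 0 < z < L).

Let z0 : 0 < z. Proof. by case/andP: z0L. Qed.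
Let zL : z < L. Proof. by case/andP: z0L. Qed.
Let L0 : 0 < L. Proof. exact: lt_trans z0 zL. Qed.

(** The two lines cross exactly at [z], which decides the minimum on either side. *)
Let tent_gap x : (L - x) * (z / L) - x * ((L - z) / L) = z - x.
Proof. by field; rewrite gt_eqF. Qed.

Lemma tent_left x : x <= z -> tent L z x = (L - z) / L * x + 0.
Proof.
move=> xz; rewrite /tent min_l; last by rewrite -subr_ge0 tent_gap subr_ge0.
by rewrite addr0 mulrC.
Qed.

Lemma tent_right x : z <= x -> tent L z x = - (z / L) * x + z.
Proof.
move=> xz; rewrite /tent min_r; last by rewrite -subr_le0 tent_gap subr_le0.
by field; rewrite gt_eqF.
Qed.

Lemma tent0 : tent L z 0 = 0.
Proof. by rewrite tent_left ?ltW// mulr0 addr0. Qed.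

Lemma tentL : tent L z L = 0.
Proof. by rewrite tent_right ?ltW//; field; rewrite gt_eqF. Qed.

Lemma pl_germs_tent a b : pl_germs a b (tent L z).
Proof.
apply: pl_germs_min.
  apply: (@pl_germs_eq _ _ _ (fun y => (L - z) / L * y + 0)).
    by move=> y _; ring.
  exact: pl_germs_affine_fun.
apply: (@pl_germs_eq _ _ _ (fun y => - (z / L) * y + L * (z / L))).
  by move=> y _; ring.
exact: pl_germs_affine_fun.
Qed.

Lemma tent_slope_right_left x : x < z -> has_slope (tent L z) x 1 ((L - z) / L).
Proof.
move=> xz; rewrite -[_ / _]mul1r; apply: (has_slope_affine (c := 0)).
exists (z - x); first by rewrite subr_gt0.
by move=> h /andP[h0 hz]; apply: tent_left; lra.
Qed.

Lemma tent_slope_right_right x : z <= x -> has_slope (tent L z) x 1 (- (z / L)).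
Proof.
move=> xz; rewrite -[- _]mul1r; apply: (has_slope_affine (c := z)).
by exists 1 => // h /andP[h0 hz]; apply: tent_right; lra.
Qed.

Lemma tent_slope_left_left x :
  x <= z -> has_slope (tent L z) x (-1) (- ((L - z) / L)).
Proof.
move=> xz; rewrite -[- (_ / _)]mulN1r; apply: (has_slope_affine (c := 0)).
by exists 1 => // h /andP[h0 hz]; apply: tent_left; lra.
Qed.

Lemma tent_slope_left_right x : z < x -> has_slope (tent L z) x (-1) (z / L).
Proof.
move=> xz; rewrite -[z / L]opprK -[- - _]mulN1r; apply: (has_slope_affine (c := z)).
exists (x - z); first by rewrite subr_gt0.
by move=> h /andP[h0 hz]; apply: tent_right; lra.
Qed.

Lemma tent_bend x : dir_slope (tent L z) x 1 + dir_slope (tent L z) x (-1) =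
  - (z == x)%:R.
Proof.
have [xz|zx|->] := ltgtP x z.
- rewrite (has_slope_dir_slope (tent_slope_right_left xz)).
  rewrite (has_slope_dir_slope (tent_slope_left_left (ltW xz))).
  by rewrite subrr oppr0.
- rewrite (has_slope_dir_slope (tent_slope_right_right (ltW zx))).
  rewrite (has_slope_dir_slope (tent_slope_left_right zx)).
  by rewrite addNr oppr0.
- rewrite (has_slope_dir_slope (tent_slope_right_right (lexx z))).
  rewrite (has_slope_dir_slope (tent_slope_left_left (lexx z))).
  by rewrite /=; field; rewrite gt_eqF.
Qed.

End Tent.

End Germs.

(** * The Laplacian *)

Section Graph.
Context {R : realType} (G : metricGraph R).
Implicit Types (e : edge G) (f g : gpoint G -> R) (p q : gpoint G).

Lemma edge_pt_src e : edge_pt e 0 = inl (src e).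
Proof. by rewrite /edge_pt insubN/= ?ltxx// lexx. Qed.

Lemma edge_pt_tgt e : edge_pt e (len e) = inl (tgt e).
Proof. by rewrite /edge_pt insubN/= ?ltxx ?andbF// leNgt len_gt0. Qed.

Lemma edge_pt_interior (y : {y : edge G * R | 0 < y.2 < len y.1}) :
  edge_pt (val y).1 (val y).2 = inr y.
Proof. by rewrite /edge_pt -surjective_pairing valK. Qed.

(** Interchangeable with [piecewise_linear] by the next two lemmas, and the form in which sums and
    minima are handled. *)
Definition locally_pl f := forall e, pl_germs 0 (len e) (f \o edge_pt e).

Lemma piecewise_linear_locally_pl f : piecewise_linear f -> locally_pl f.
Proof. by move=> fpl e; exact/piecewise_linear_on_pl_germs. Qed.

Lemma locally_pl_piecewise_linear f : locally_pl f -> piecewise_linear f.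
Proof.
by move=> fpl e; apply: pl_germs_piecewise_linear_on (fpl e); rewrite ltW ?len_gt0.
Qed.

Lemma locally_plD f g : locally_pl f -> locally_pl g ->
  locally_pl (fun p => f p + g p).
Proof. by move=> fpl gpl e; exact: pl_germsD (fpl e) (gpl e). Qed.

Lemma locally_plZ c f : locally_pl f -> locally_pl (fun p => c * f p).
Proof. by move=> fpl e; exact: pl_germsZ (fpl e). Qed.

Lemma locally_plB f g : locally_pl f -> locally_pl g ->
  locally_pl (fun p => f p - g p).
Proof.
move=> fpl gpl; under eq_fun do rewrite -mulN1r.
by apply: locally_plD => //; exact: locally_plZ.
Qed.

Lemma locally_pl_cst c : locally_pl (fun=> c).
Proof. by move=> e; exact: pl_germs_cst. Qed.

Lemma locally_pl_min f g : locally_pl f -> locally_pl g ->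
  locally_pl (fun p => Num.min (f p) (g p)).
Proof. by move=> fpl gpl e; exact: pl_germs_min (fpl e) (gpl e). Qed.

Lemma locally_pl_sum (I : Type) (s : seq I) (F : I -> gpoint G -> R) :
  (forall i, locally_pl (F i)) -> locally_pl (fun p => \sum_(i <- s) F i p).
Proof.
move=> Fpl; elim: s => [|i s IH].
  by under eq_fun do rewrite big_nil; exact: locally_pl_cst.
by under eq_fun do rewrite big_cons; exact: locally_plD.
Qed.

Lemma laplacianE_vertex f v : laplacian f (inl v) =
  - (\sum_(e | src e == v) dir_slope (f \o edge_pt e) 0 1 +
     \sum_(e | tgt e == v) dir_slope (f \o edge_pt e) (len e) (-1)).
Proof. by []. Qed.

Lemma laplacianE_interior f y : laplacian f (inr y) =
  - (dir_slope (f \o edge_pt (val y).1) (val y).2 1 +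
     dir_slope (f \o edge_pt (val y).1) (val y).2 (-1)).
Proof. by rewrite /laplacian/=; case: (\val y). Qed.

(** Local piecewise linearity makes every directional slope a genuine value, so the limits in
    [dir_slope] combine linearly. *)
Lemma laplacian_lin c f g q : locally_pl f -> locally_pl g ->
  laplacian (fun p => c * f p + g p) q = c * laplacian f q + laplacian g q.
Proof.
move=> fpl gpl.
have slopeE e x s : (exists k, has_slope (f \o edge_pt e) x s k) ->
    (exists k, has_slope (g \o edge_pt e) x s k) ->
    dir_slope ((fun p => c * f p + g p) \o edge_pt e) x s =
    c * dir_slope (f \o edge_pt e) x s + dir_slope (g \o edge_pt e) x s.
  move=> [k fk] [k' gk]; rewrite (has_slope_dir_slope fk).
  rewrite (has_slope_dir_slope gk); apply: has_slope_dir_slope.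
  exact: has_slopeD (has_slopeZ c fk) gk.
have right e x : 0 <= x < len e ->
    dir_slope ((fun p => c * f p + g p) \o edge_pt e) x 1 =
    c * dir_slope (f \o edge_pt e) x 1 + dir_slope (g \o edge_pt e) x 1.
  by move=> xe; apply: slopeE; [exact: (fpl e).1|exact: (gpl e).1].
have left e x : 0 < x <= len e ->
    dir_slope ((fun p => c * f p + g p) \o edge_pt e) x (-1) =
    c * dir_slope (f \o edge_pt e) x (-1) + dir_slope (g \o edge_pt e) x (-1).
  by move=> xe; apply: slopeE; [exact: (fpl e).2|exact: (gpl e).2].
case: q => [v|y].
  rewrite !laplacianE_vertex.
  under eq_bigr do rewrite right ?lexx ?len_gt0//.
  under [X in _ + X]eq_bigr do rewrite left ?lexx ?len_gt0//.
  by rewrite !big_split/= -!mulr_sumr; ring.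
rewrite !laplacianE_interior; have /andP[y0 yl] := valP y.
by rewrite right ?(ltW y0) ?yl// left ?(ltW yl) ?y0//; ring.
Qed.

Lemma laplacian_cst c q : laplacian (fun=> c) q = 0 :> R.
Proof.
have slope e x s : dir_slope ((fun=> c) \o @edge_pt _ G e) x s = 0.
  exact/has_slope_dir_slope/has_slope_cst.
case: q => [v|y]; rewrite ?laplacianE_vertex ?laplacianE_interior ?slope.
  by rewrite !big1 ?addr0 ?oppr0.
by rewrite addr0 oppr0.
Qed.

Lemma laplacianD f g q : locally_pl f -> locally_pl g ->
  laplacian (fun p => f p + g p) q = laplacian f q + laplacian g q.
Proof.
move=> fpl gpl; rewrite -[X in X + _]mul1r -laplacian_lin//.
by under [in RHS]eq_fun do rewrite mul1r.
Qed.

Lemma laplacianZ c f q : locally_pl f ->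
  laplacian (fun p => c * f p) q = c * laplacian f q.
Proof.
move=> fpl; rewrite -[RHS]addr0 -[X in _ + X](laplacian_cst 0 q).
rewrite -laplacian_lin//; last exact: locally_pl_cst.
by under [in RHS]eq_fun do rewrite addr0.
Qed.

Lemma laplacianB f g q : locally_pl f -> locally_pl g ->
  laplacian (fun p => f p - g p) q = laplacian f q - laplacian g q.
Proof.
move=> fpl gpl; rewrite -[X in _ + X]mulN1r addrC -laplacian_lin//.
by under [in RHS]eq_fun do rewrite mulN1r addrC.
Qed.

Lemma laplacian_sum (I : Type) (s : seq I) (F : I -> gpoint G -> R) q :
  (forall i, locally_pl (F i)) ->
  laplacian (fun p => \sum_(i <- s) F i p) q = \sum_(i <- s) laplacian (F i) q.
Proof.
move=> Fpl; elim: s => [|i s IH].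
  by under eq_fun do rewrite big_nil; rewrite laplacian_cst big_nil.
rewrite big_cons -IH -laplacianD//; last exact: locally_pl_sum.
by under eq_fun do rewrite big_cons.
Qed.

(** * The Laplacian of the finite weighted graph on the vertices *)

Lemma sum_fiber (A B : finType) (h : A -> B) (w : B -> R) (F : A -> R) :
  \sum_b w b * \sum_(a | h a == b) F a = \sum_a w (h a) * F a.
Proof.
rewrite [RHS](partition_big h predT)//=; apply: eq_bigr => b _.
by rewrite mulr_sumr; apply: eq_bigr => a /eqP ->.
Qed.

(** The graph Laplacian with conductances [1 / len e]. The signs match [laplacian], and loops
    contribute 0. *)
Definition vertex_laplacian (v : vertex G -> R) (u : vertex G) : R :=
  \sum_(e | src e == u) (v (src e) - v (tgt e)) / len e +
  \sum_(e | tgt e == u) (v (tgt e) - v (src e)) / len e.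

(** Summation by parts: each edge collects the contributions of its two ends. For [w = v] the
    right-hand side is the Dirichlet energy. *)
Lemma vertex_laplacian_energy (w v : vertex G -> R) :
  \sum_u w u * vertex_laplacian v u =
  \sum_e (w (src e) - w (tgt e)) * (v (src e) - v (tgt e)) / len e.
Proof.
under eq_bigr do rewrite mulrDr; rewrite big_split/= !sum_fiber -big_split/=.
by apply: eq_bigr => e _; ring.
Qed.

Lemma vertex_laplacian_sum (v : vertex G -> R) :
  \sum_u vertex_laplacian v u = 0.
Proof.
transitivity (\sum_u 1 * vertex_laplacian v u).
  by apply: eq_bigr => u _; rewrite mul1r.
by rewrite (vertex_laplacian_energy (fun=> 1)) big1// => e _; rewrite subrr !mul0r.
Qed.

(** The Dirichlet energy vanishes and its terms are nonnegative, so [v] agrees at the ends of every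
    edge; connectedness does the rest. *)
Lemma vertex_laplacian_ker (v : vertex G -> R) :
  (forall u, vertex_laplacian v u = 0) -> forall u u', v u = v u'.
Proof.
move=> Lv0; have edge_eq e : v (src e) = v (tgt e).
  have := vertex_laplacian_energy v v.
  rewrite big1; last by move=> u _; rewrite Lv0 mulr0.
  move/esym => /psumr_eq0P /(_ e isT) /eqP; rewrite -expr2.
  rewrite mulf_eq0 invr_eq0 (gt_eqF (len_gt0 _)) orbF sqrf_eq0 subr_eq0.
  move=> H; apply/eqP/H => e' _.
  by rewrite -expr2 divr_ge0 ?sqr_ge0// ltW ?len_gt0.
move=> u u'; have /connectP[s + ->] := graph_connected u u'.
elim: s u => //= u1 s IH u /andP[/existsP[e ue] /IH <-].
by case/orP: ue => /andP[/eqP<- /eqP<-]; rewrite edge_eq.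
Qed.

(* The vertex Laplacian plus the total sum is an injective, hence surjective,
   endomorphism. *)
Definition reg_laplacian (v : {ffun vertex G -> R^o}) : {ffun vertex G -> R^o} :=
  [ffun u => vertex_laplacian v u + \sum_w v w].

Fact reg_laplacian_linear : linear reg_laplacian.
Proof.
move=> c v w; apply/ffunP => u; rewrite !ffunE /vertex_laplacian.
have E e a b : ((c *: v + w) a - (c *: v + w) b) / len e =
    c * ((v a - v b) / len e) + (w a - w b) / len e.
  by rewrite !ffunE /GRing.scale/=; ring.
under eq_bigr do rewrite E; under [X in _ + X + _ = _]eq_bigr do rewrite E.
under [X in _ + X = _]eq_bigr do rewrite !ffunE.
by rewrite !big_split/= -!mulr_sumr /GRing.scale/=; ring.
Qed.

HB.instance Definition _ :=
  GRing.isLinear.Build R {ffun vertex G -> R^o} {ffun vertex G -> R^o} _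
    reg_laplacian reg_laplacian_linear.

(** Summing over all vertices kills the Laplacian and leaves the total of [v] times the number of
    vertices. *)
Lemma sum_eq0_of_reg_laplacian (v : {ffun vertex G -> R^o}) (b : vertex G -> R) :
  (forall u, reg_laplacian v u = b u) -> \sum_u b u = 0 -> \sum_u v u = 0.
Proof.
move=> vb b0; have [u _|V0] := pickP (@predT (vertex G)); last first.
  by rewrite big_pred0// => u; exact: V0.
have := b0; under eq_bigr do rewrite -vb ffunE.
rewrite big_split/= vertex_laplacian_sum add0r sumr_const -mulr_natr.
move/eqP; rewrite mulf_eq0 pnatr_eq0 => /orP[/eqP//|/eqP V0].
by have := max_card (pred1 u); rewrite card1 V0.
Qed.

Lemma reg_laplacian_inj : injective reg_laplacian.
Proof.
move=> v w vw; apply/eqP; rewrite -subr_eq0; apply/eqP/ffunP => u.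
have A0 : reg_laplacian (v - w) = 0 by rewrite raddfB/= vw subrr.
have A0u u' : reg_laplacian (v - w) u' = 0 by rewrite A0 ffunE.
have S0 := sum_eq0_of_reg_laplacian A0u (big1 _ _ _ (fun _ _ => erefl)).
have L0 u' : vertex_laplacian (v - w) u' = 0.
  by have := A0u u'; rewrite ffunE S0 addr0.
have := S0; under eq_bigr => u' _ do rewrite (vertex_laplacian_ker L0 u' u).
rewrite sumr_const -mulr_natr.
move/eqP; rewrite mulf_eq0 pnatr_eq0 => /orP[/eqP->|/eqP V0]; first by rewrite ffunE.
by have := max_card (pred1 u); rewrite card1 V0.
Qed.

(** In finite dimension the injective [reg_laplacian] is invertible, and its solution has total 0,
    so the regularising term disappears. *)
Lemma vertex_laplacian_solve (b : vertex G -> R) : \sum_u b u = 0 ->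
  exists v, forall u, vertex_laplacian v u = b u.
Proof.
move=> b0; pose A := linfun reg_laplacian.
have kerA : lker A == 0%VS.
  by apply/lker0P => v w; rewrite !lfunE => /reg_laplacian_inj.
pose v := (A^-1)%VF [ffun u => b u : R^o].
have vb u : reg_laplacian v u = b u.
  by rewrite -[reg_laplacian v]lfunE lker0_lfunVK// ffunE.
exists v => u; have := vb u; rewrite ffunE.
by rewrite (sum_eq0_of_reg_laplacian vb b0) addr0.
Qed.

End Graph.

(** * Existence and uniqueness of potentials *)

Section Potential.
Context {R : realType} (G : metricGraph R).
Implicit Types (e : edge G) (f g : gpoint G -> R) (p q : gpoint G).

(** * Functions that are affine on every edge *)

Definition interpolation (v : vertex G -> R) q : R :=
  match q with
  | inl u => v u
  | inr z => let: (e, x) := val z in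
             (v (tgt e) - v (src e)) / len e * x + v (src e)
  end.

Lemma edge_pt_interior_in e x (xe : 0 < x < len e) :
  edge_pt e x = inr (exist _ (e, x) xe : {y : edge G * R | 0 < y.2 < len y.1}).
Proof. by rewrite -edge_pt_interior. Qed.

(** [edge_pt] computes differently at the two ends and in the interior, so identities along a closed
    edge are checked in these three cases. *)
Lemma closed_edge_ind (P : R -> Prop) e :
  P 0 -> P (len e) -> (forall x, 0 < x < len e -> P x) ->
  forall x, 0 <= x <= len e -> P x.
Proof.
move=> P0 Pl Pi x /andP[]; rewrite le_eqVlt => /predU1P[<-//|x0].
by rewrite le_eqVlt => /predU1P[->//|xl]; apply: Pi; rewrite x0.
Qed.

Lemma interpolation_edge v e x : 0 <= x <= len e ->
  (interpolation v \o edge_pt e) x =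
  (v (tgt e) - v (src e)) / len e * x + v (src e).
Proof.
move: x; apply: closed_edge_ind => [||x xe] /=.
- by rewrite edge_pt_src/= mulr0 add0r.
- by rewrite edge_pt_tgt/= divfK ?subrK// gt_eqF ?len_gt0.
- by rewrite edge_pt_interior_in.
Qed.

Lemma locally_pl_interpolation v : locally_pl (interpolation v).
Proof.
move=> e; apply: (pl_germs_eq (interpolation_edge v (e := e))).
exact: pl_germs_affine_fun.
Qed.

Lemma affine_edge_slopes (g : R -> R) k c e x :
  (forall x, 0 <= x <= len e -> g x = k * x + c) ->
  (0 <= x < len e -> dir_slope g x 1 = k) /\
  (0 < x <= len e -> dir_slope g x (-1) = - k).
Proof.
move=> gE; split=> xe; apply: has_slope_dir_slope.
  apply: (has_slope_right_eq gE xe).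
  by rewrite -[X in has_slope _ _ _ X]mul1r; apply: has_slope_affine; exists 1.
apply: (has_slope_left_eq gE xe).
by rewrite -[X in has_slope _ _ _ X]mulN1r; apply: has_slope_affine; exists 1.
Qed.

(** Opposite slopes cancel at interior points, and at a vertex the outgoing slopes are difference
    quotients. This serves both interpolations and harmonic functions. *)
Lemma laplacian_affine_edges f :
  (forall e x, 0 <= x <= len e -> f (edge_pt e x) =
     (f (inl (tgt e)) - f (inl (src e))) / len e * x + f (inl (src e))) ->
  forall q, laplacian f q =
    if q is inl u then vertex_laplacian (f \o inl) u else 0.
Proof.
move=> fE [u|y].
  rewrite laplacianE_vertex /vertex_laplacian opprD -!sumrN.
  congr (_ + _); apply: eq_bigr => e _.
    rewrite (affine_edge_slopes 0 (fE e)).1 ?lexx ?len_gt0//=.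
    by rewrite -mulNr opprB.
  by rewrite (affine_edge_slopes (len e) (fE e)).2 ?lexx ?len_gt0// opprK.
have /andP[y0 yl] := valP y; rewrite laplacianE_interior.
rewrite (affine_edge_slopes _ (fE _)).1 ?(ltW y0)//.
by rewrite (affine_edge_slopes _ (fE _)).2 ?(ltW yl) ?y0// subrr oppr0.
Qed.

Lemma laplacian_interpolation v q : laplacian (interpolation v) q =
  if q is inl u then vertex_laplacian v u else 0.
Proof. by rewrite laplacian_affine_edges// => e x /(interpolation_edge v). Qed.

(** * Hat functions, moving interior masses to the vertices *)

(** A tent with peak at [p] on the edge of [p]. It is 0 when [p] is a vertex, whose mass is already
    in place. *)
Definition hat p q : R :=
  match p, q with
  | inr y, inr z => if (val y).1 == (val z).1
                    then tent (len (val y).1) (val y).2 (val z).2 else 0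
  | _, _ => 0
  end.

Lemma hat_edge (y : {y : edge G * R | 0 < y.2 < len y.1}) e x :
  0 <= x <= len e -> (hat (inr y) \o edge_pt e) x =
  if (val y).1 == e then tent (len e) (val y).2 x else 0.
Proof.
move: x; apply: closed_edge_ind => [||x xe] /=.
- rewrite edge_pt_src/=; case: eqP => // <-; rewrite tent0//; exact: valP y.
- rewrite edge_pt_tgt/=; case: eqP => // <-; rewrite tentL//; exact: valP y.
- by rewrite edge_pt_interior_in/=; case: eqP => // ->.
Qed.

Lemma locally_pl_hat p : locally_pl (hat p).
Proof.
case: p => [v|y] e; first exact: pl_germs_cst.
apply: (pl_germs_eq (hat_edge y (e := e))).
case: eqP => [<-|_]; last exact: pl_germs_cst.
exact: pl_germs_tent.
Qed.

Lemma laplacian_hat_interior p y : laplacian (hat p) (inr y) = (p == inr y)%:R.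
Proof.
case: p => [v|z]; first by rewrite laplacian_cst.
have /andP[y0 yl] := valP y; rewrite laplacianE_interior.
rewrite (_ : (inr z == inr y) = (val z == val y))//.
set e := (val y).1; set g := fun x => if (val z).1 == e
  then tent (len e) (val z).2 x else 0.
have gpl : pl_germs 0 (len e) g.
  rewrite /g; case: eqP => [ze|_]; last exact: pl_germs_cst.
  exact: pl_germs_tent.
(* That [g] has some slopes is enough to trade the directional slopes of the hat for those of
   [g]. *)
have [|k gk] := gpl.1 (val y).2; first by rewrite (ltW y0).
have [|k' gk'] := gpl.2 (val y).2; first by rewrite (ltW yl) y0.
rewrite (has_slope_dir_slope (has_slope_right_eq (hat_edge z (e := e)) _ gk));
  last by rewrite (ltW y0).
rewrite (has_slope_dir_slope (has_slope_left_eq (hat_edge z (e := e)) _ gk'));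
  last by rewrite (ltW yl) y0.
rewrite -(has_slope_dir_slope gk) -(has_slope_dir_slope gk') /g.
rewrite (_ : (val z == val y) = ((val z).1 == e) && ((val z).2 == (val y).2))//.
case: eqP => [ze|_] /=; last first.
  have E s : dir_slope (fun=> 0 : R) (val y).2 s = 0.
    exact/has_slope_dir_slope/has_slope_cst.
  by rewrite !E addr0 oppr0.
by rewrite tent_bend ?opprK// -ze; exact: valP z.
Qed.

(** A unit mass at distance [x] from the source of an edge of length [l] is split into [(l - x) / l]
    at the source and [x / l] at the target. *)
Lemma laplacian_hat_sum p :
  \sum_u ((p == inl u)%:R - laplacian (hat p) (inl u)) = 1.
Proof.
case: p => [v|y].
  rewrite (bigD1 v)//= big1 => [|u uv]; last first.
    by rewrite laplacian_cst (_ : (inl v == inl u) = (v == u))// eq_sym (negbTE uv) subrr.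
  by rewrite eqxx laplacian_cst addr0 subr0.
set e := (val y).1; have /andP[y0 yl] := valP y.
have l0 := len_gt0 e.
have src_slope e' : dir_slope (hat (inr y) \o edge_pt e') 0 1 =
    if e' == e then (len e - (val y).2) / len e else 0.
  apply: has_slope_dir_slope; apply: (has_slope_right_eq (hat_edge y (e := e'))).
    by rewrite lexx len_gt0.
  have [->|_] := eqVneq e' e; last exact: has_slope_cst.
  by apply: tent_slope_right_left => //; exact: valP y.
have tgt_slope e' : dir_slope (hat (inr y) \o edge_pt e') (len e') (-1) =
    if e' == e then (val y).2 / len e else 0.
  apply: has_slope_dir_slope; apply: (has_slope_left_eq (hat_edge y (e := e'))).
    by rewrite lexx len_gt0.
  have [->|_] := eqVneq e' e; last exact: has_slope_cst.
  by apply: tent_slope_left_right => //; exact: valP y.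
under eq_bigr do rewrite sub0r laplacianE_vertex opprK.
have fiber (h : edge G -> vertex G) (F : edge G -> R) :
    \sum_u \sum_(e' | h e' == u) F e' = \sum_e' F e'.
  by rewrite [RHS](partition_big h predT).
rewrite big_split/= !fiber.
under eq_bigr do rewrite src_slope.
under [X in _ + X]eq_bigr do rewrite tgt_slope.
by rewrite -!big_mkcond !big_pred1_eq -mulrDl subrK divff// gt_eqF.
Qed.

Section Divisors.
Context {d : R}.
Implicit Types D : effDivisor G d.

(** Reduces linear computations on divisors to a single point mass. *)
Lemma divisor_sum (D : {fsfun gpoint G -> R with 0}) q :
  D q = \sum_(p <- finsupp D) D p * (p == q)%:R.
Proof.
have [qD|qD] := boolP (q \in finsupp D); last first.
  rewrite fsfun_dflt// big_seq big1// => p pD; case: eqP => [pq|_]; last by rewrite mulr0.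
  by rewrite -pq pD in qD.
rewrite (bigD1_seq q) ?fset_uniq//= eqxx mulr1 big1 ?addr0// => p /negbTE ->.
by rewrite mulr0.
Qed.

(* The function pushing the mass of [D] at interior points to the vertices. *)
Definition hats D q := \sum_(p <- finsupp D) D p * hat p q.

Lemma locally_pl_hats D : locally_pl (hats D).
Proof.
by apply: locally_pl_sum => p; apply: locally_plZ; exact: locally_pl_hat.
Qed.

Lemma laplacian_hats D q :
  laplacian (hats D) q = \sum_(p <- finsupp D) D p * laplacian (hat p) q.
Proof.
rewrite laplacian_sum; last by move=> p; apply: locally_plZ; exact: locally_pl_hat.
by apply: eq_bigr => p _; rewrite laplacianZ//; exact: locally_pl_hat.
Qed.

Lemma laplacian_hats_interior D y : laplacian (hats D) (inr y) = D (inr y).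
Proof.
rewrite laplacian_hats divisor_sum; apply: eq_bigr => p _.
by rewrite laplacian_hat_interior.
Qed.

(** Each point mass keeps its total when pushed to the vertices, so the degree is preserved. *)
Lemma laplacian_hats_sum D :
  \sum_u (D (inl u) - laplacian (hats D) (inl u)) = d.
Proof.
under eq_bigr do rewrite laplacian_hats divisor_sum -sumrB.
rewrite exchange_big/=; apply: etrans (effDivisor_degree D); apply: eq_bigr => p _.
under eq_bigr do rewrite -mulrBr.
by rewrite -mulr_sumr laplacian_hat_sum mulr1.
Qed.

(** The hats account for the interior masses. What remains lives on the vertices and has total 0,
    both degrees being [d], so an interpolated solution of the vertex problem supplies it. *)
Lemma potential_exists D1 D2 : exists f, piecewise_linear f /\
  forall p, laplacian f p = D2 p - D1 p.
Proof.
pose b D u := D (inl u) - laplacian (hats D) (inl u).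
have b0 : \sum_u (b D2 u - b D1 u) = 0.
  by rewrite sumrB !laplacian_hats_sum subrr.
have [v Lv] := vertex_laplacian_solve b0.
have hpl : locally_pl (fun p => hats D2 p - hats D1 p).
  by apply: locally_plB; exact: locally_pl_hats.
have vpl := locally_pl_interpolation v.
exists (fun p => (hats D2 p - hats D1 p) + interpolation v p); split.
  by apply: locally_pl_piecewise_linear; exact: locally_plD.
move=> q; rewrite laplacianD// laplacianB ?laplacian_interpolation;
  [|exact: locally_pl_hats..].
case: q => [u|y]; last by rewrite !laplacian_hats_interior addr0.
by rewrite Lv /b; ring.
Qed.

End Divisors.

(** * Harmonic functions, and boundedness *)

Lemma harmonic_cst f : locally_pl f -> (forall q, laplacian f q = 0) ->
  forall p q, f p = f q.
Proof.
move=> fpl fh.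
have fE e x : 0 <= x <= len e -> f (edge_pt e x) =
     (f (inl (tgt e)) - f (inl (src e))) / len e * x + f (inl (src e)).
  have l0 := len_gt0 e.
  have [|k fk] := pl_germs_affine l0 (fpl e).
    move=> z ze; have := fh (edge_pt e z).
    rewrite edge_pt_interior_in laplacianE_interior/= => /eqP.
    by rewrite oppr_eq0 => /eqP.
  have := fk (len e); rewrite lexx (ltW l0) /= edge_pt_tgt edge_pt_src => /(_ isT) ->.
  by move=> /fk /= ->; rewrite edge_pt_src; field; rewrite gt_eqF.
have ker u : vertex_laplacian (f \o inl) u = 0.
  by rewrite -(laplacian_affine_edges fE (inl u)).
have fvv u w : f (inl u) = f (inl w) := vertex_laplacian_ker ker u w.
(* The vertex values being equal, the affine function on each edge has slope 0. *)
have fv p : exists u, f p = f (inl u).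
  case: p => [u|y]; first by exists u.
  exists (src (val y).1); rewrite -edge_pt_interior fE.
    by rewrite (fvv _ (src (val y).1)) subrr !mul0r add0r.
  by have /andP[/ltW -> /ltW ->] := valP y.
by move=> p q; have [u ->] := fv p; have [w ->] := fv q; exact: fvv.
Qed.

(** Makes the [sup] and [inf] in [rho] genuine bounds. Finite sums of the bounds stand in for a
    maximum over vertices and edges. *)
Lemma piecewise_linear_bounded f : piecewise_linear f ->
  exists M, forall p, `|f p| <= M.
Proof.
move=> fpl; have /choice[M HM] e := piecewise_linear_on_bounded (fpl e).
have M0 e : 0 <= M e.
  by apply: le_trans (HM e 0 _) => //; rewrite lexx ltW ?len_gt0.
exists (\sum_u `|f (inl u)| + \sum_e M e) => -[u|y].
  by rewrite (bigD1 u)//= -addrA lerDl addr_ge0// sumr_ge0.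
rewrite -edge_pt_interior.
have /andP[/ltW y0 /ltW yl] := valP y.
apply: le_trans (HM (val y).1 (val y).2 _) _; first by rewrite y0.
rewrite addrC (bigD1 (val y).1)//= -addrA lerDl addr_ge0// ?sumr_ge0//.
Qed.

End Potential.

(** * The metric and the tropical paths *)

Section Metric.
Context {R : realType} (G : metricGraph R) {d : R}.
Implicit Types (D E : effDivisor G d) (f g : gpoint G -> R) (p q : gpoint G).

Lemma effDivisor_eq D E : (forall p, D p = E p) -> D = E.
Proof.
case: D E => [D De Dd] [E Ee Ed] /= DE.
have {DE}DE : D = E by apply/fsfunP.
by rewrite {}DE in De Dd *; congr EffDivisor; exact: Prop_irrelevance.
Qed.

Lemma potentialP D E : piecewise_linear (potential D E) /\
  forall p, laplacian (potential D E) p = E p - D p.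
Proof. exact: xgetPex (potential_exists D E). Qed.

Lemma potential_pl D E : locally_pl (potential D E).
Proof. exact/piecewise_linear_locally_pl/(potentialP D E).1. Qed.

Lemma laplacian_potential D E p : laplacian (potential D E) p = E p - D p.
Proof. exact: (potentialP D E).2. Qed.

(** Two solutions differ by a harmonic function, hence by a constant; differences of values absorb
    it. *)
Lemma potential_unique D E f : locally_pl f ->
  (forall p, laplacian f p = E p - D p) ->
  forall p q, potential D E p - potential D E q = f p - f q.
Proof.
move=> fpl fE p q; have PDE := potential_pl D E.
have gpl := locally_plB PDE fpl.
have gh r : laplacian (fun p => potential D E p - f p) r = 0.
  by rewrite laplacianB// laplacian_potential fE subrr.
by have := harmonic_cst gpl gh p q; lra.
Qed.

Lemma potential_range D E :
  has_ubound (range (potential D E)) /\ has_lbound (range (potential D E)).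
Proof.
have [M HM] := piecewise_linear_bounded (potentialP D E).1.
split; [exists M|exists (- M)] => _ [p _ <-];
  by have := HM p; rewrite ler_norml => /andP[].
Qed.

Lemma potential_ge_inf D E p : inf (range (potential D E)) <= potential D E p.
Proof. by apply: ge_inf; [exact: (potential_range D E).2|exists p]. Qed.

Lemma potential_le_sup D E p : potential D E p <= sup (range (potential D E)).
Proof. by apply: ub_le_sup; [exact: (potential_range D E).1|exists p]. Qed.

Lemma potential_sub_le_rho D E p q :
  potential D E p - potential D E q <= rho D E.
Proof. by apply: lerB; [exact: potential_le_sup|exact: potential_ge_inf]. Qed.

Lemma rho_ge0 D E : 0 <= rho D E.
Proof.
(* In a graph without points the range is empty, and its [sup] and [inf] are both 0 by default. *)
have [[p _]|/nonemptyPn G0] := pselect ([set: gpoint G] !=set0).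
  by have := potential_sub_le_rho D E p p; rewrite subrr.
by rewrite /rho G0 !image_set0 sup0 inf0 subrr.
Qed.

(** Any solution of the Poisson equation has the oscillation of the chosen potential, so bounds on
    [rho] follow from convenient solutions. *)
Lemma rho_le D E f M : locally_pl f -> (forall p, laplacian f p = E p - D p) ->
  0 <= M -> (forall p q, f p - f q <= M) -> rho D E <= M.
Proof.
move=> fpl fE M0 fM.
have [[o _]|/nonemptyPn G0] := pselect ([set: gpoint G] !=set0); last first.
  by rewrite /rho G0 !image_set0 sup0 inf0 subrr.
have ne : range (potential D E) !=set0 by exists (potential D E o), o.
rewrite /rho lerBlDr; apply: ge_sup => // _ [p _ <-].
rewrite addrC -lerBlDr; apply: lb_le_inf => // _ [q _ <-].
by rewrite lerBlDr -lerBlDl (potential_unique fpl fE).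
Qed.

(** The sum of two consecutive potentials solves the composite equation, and oscillation is
    subadditive. *)
Lemma rho_triangle D1 D2 D3 : rho D1 D3 <= rho D1 D2 + rho D2 D3.
Proof.
apply: (@rho_le _ _ (fun p => potential D1 D2 p + potential D2 D3 p)).
- by apply: locally_plD; exact: potential_pl.
- by move=> p; rewrite laplacianD ?laplacian_potential; [ring|exact: potential_pl..].
- by rewrite addr_ge0 ?rho_ge0.
- move=> p q; have := potential_sub_le_rho D1 D2 p q.
  by have := potential_sub_le_rho D2 D3 p q; lra.
Qed.

Lemma rho_sym D E : rho D E = rho E D.
Proof.
suff H D1 D2 : rho D1 D2 <= rho D2 D1 by apply/eqP; rewrite eq_le !H.
apply: (@rho_le _ _ (fun p => -1 * potential D2 D1 p)).
- by apply: locally_plZ; exact: potential_pl.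
- move=> p; rewrite laplacianZ; last exact: potential_pl.
  by rewrite laplacian_potential; ring.
- exact: rho_ge0.
- by move=> p q; have := potential_sub_le_rho D2 D1 q p; lra.
Qed.

Lemma rho_refl D : rho D D = 0.
Proof.
apply/eqP; rewrite eq_le rho_ge0 andbT; apply: (@rho_le _ _ (fun=> 0)) => //.
- exact: locally_pl_cst.
- by move=> p; rewrite laplacian_cst subrr.
- by move=> p q; rewrite subrr.
Qed.

Lemma nbhs_rho_ball D r : 0 < r -> nbhs D [set E | rho D E < r].
Proof.
move=> r0; rewrite nbhsE; exists [set E | rho D E < r] => //; split => /=.
  move=> E /= DE; exists (r - rho D E); first by rewrite subr_gt0.
  by move=> F EF /=; apply: le_lt_trans (rho_triangle D E F) _; lra.
by rewrite rho_refl.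
Qed.

Lemma nbhs_rhoP D (U : set (effDivisor G d)) : nbhs D U ->
  exists2 r, 0 < r & forall E, rho D E < r -> U E.
Proof.
rewrite nbhsE => -[V [oV VD] VU]; have [r r0 rV] := oV D VD.
by exists r => // E /rV /VU.
Qed.

(** * Heights and the dependence of tropical paths on their data *)

Definition height D E p := potential D E p - inf (range (potential D E)).

Lemma height_pl D E : locally_pl (height D E).
Proof. by apply: locally_plD; [exact: potential_pl|exact: locally_pl_cst]. Qed.

Lemma laplacian_height D E p : laplacian (height D E) p = E p - D p.
Proof.
rewrite laplacianD; [|exact: potential_pl|exact: locally_pl_cst].
by rewrite laplacian_cst addr0 laplacian_potential.
Qed.

Lemma tpath0 D E p : tpath D E 0 p = D p.
Proof.
have -> : tpath D E 0 p = D p + laplacian (fun=> 0) p.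
  congr (_ + laplacian _ p); apply/funext => q; rewrite mul0r; apply/min_idPl.
  by rewrite subr_ge0 potential_ge_inf.
by rewrite laplacian_cst addr0.
Qed.

(** The height never exceeds [rho D E], so truncating it there changes nothing. *)
Lemma tpath1 D E p : tpath D E 1 p = E p.
Proof.
have -> : tpath D E 1 p = D p + laplacian (height D E) p.
  congr (_ + laplacian _ p); apply/funext => q; rewrite mul1r; apply/min_idPr.
  by rewrite lerD2r potential_le_sup.
by rewrite laplacian_height; ring.
Qed.

(** The two potentials differ by [potential D D'] up to a constant. Comparing [p] with each [q]
    tested for the infimum costs a single oscillation of it, so normalising does not double the
    bound. *)
Lemma height_dist D D' E p : `|height D' E p - height D E p| <= rho D D'.
Proof.
suff {D D'}H D D' : height D' E p - height D E p <= rho D D'.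
  by rewrite ler_norml H andbT lerNl opprB rho_sym H.
have ne : range (potential D E) !=set0 by exists (potential D E p), p.
have ne' : range (potential D' E) !=set0 by exists (potential D' E p), p.
suff : inf (range (potential D E)) <= inf (range (potential D' E)) +
    (potential D E p - potential D' E p) + rho D D' by rewrite /height; lra.
rewrite -lerBlDr -lerBlDr; apply: lb_le_inf => // _ [q _ <-].
have : potential D E p - potential D E q =
    potential D D' p + potential D' E p - (potential D D' q + potential D' E q).
  apply: (@potential_unique D E (fun p => potential D D' p + potential D' E p)).
    by apply: locally_plD; exact: potential_pl.
  by move=> r; rewrite laplacianD ?laplacian_potential; [ring|exact: potential_pl..].
have := potential_ge_inf D E q; have := potential_sub_le_rho D D' q p.
by lra.
Qed.

Lemma rho_dist D D' E : `|rho D' E - rho D E| <= rho D D'.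
Proof.
rewrite ler_norml; have := rho_triangle D D' E.
by have := rho_triangle D' D E; rewrite (rho_sym D' D); lra.
Qed.

Lemma min_dist (a a' b b' : R) :
  `|Num.min a' b' - Num.min a b| <= `|a' - a| + `|b' - b|.
Proof.
suff H (x x' y y' : R) : Num.min x' y' - Num.min x y <= `|x' - x| + `|y' - y|.
  rewrite ler_norml H andbT lerNl opprB (le_trans (H _ _ _ _))//.
  by rewrite distrC (distrC b).
have := ler_norm (x' - x); have := ler_norm (y' - y).
have := normr_ge0 (x' - x); have := normr_ge0 (y' - y).
by have [|] := leP x' y'; have [|] := leP x y; lra.
Qed.

(** A potential from [F] to [F'] is [potential D D'] plus the difference of the truncated heights.
    It oscillates by at most [rho D D'] plus twice the uniform bound on that difference. *)
Lemma tpath_dist D D' E (F F' : effDivisor G d) (t t' : R) : 0 <= t' <= 1 ->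
  (forall p, F p = tpath D E t p) -> (forall p, F' p = tpath D' E t' p) ->
  rho F F' <= 5 * rho D D' + 2 * (`|t' - t| * rho D E).
Proof.
move=> /andP[t0 t1] FE F'E.
set r := rho D D'; pose a := t * rho D E; pose a' := t' * rho D' E.
have aa : `|a' - a| <= r + `|t' - t| * rho D E.
  (* The change of threshold is split so that the change of [rho] carries the factor [t' <= 1] and
     the change of time carries the fixed [rho D E]. *)
  have -> : a' - a = t' * (rho D' E - rho D E) + (t' - t) * rho D E.
    by rewrite /a /a'; ring.
  apply: le_trans (ler_normD _ _) _; rewrite !normrM (ger0_norm t0).
  rewrite (ger0_norm (rho_ge0 D E)) lerD2r.
  by apply: le_trans (rho_dist D D' E); rewrite ler_piMl.
pose m p := Num.min a (height D E p); pose m' p := Num.min a' (height D' E p).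
have Fm p : F p = D p + laplacian m p by exact: FE p.
have F'm' p : F' p = D' p + laplacian m' p by exact: F'E p.
have mpl : locally_pl m.
  by apply: locally_pl_min; [exact: locally_pl_cst|exact: height_pl].
have m'pl : locally_pl m'.
  by apply: locally_pl_min; [exact: locally_pl_cst|exact: height_pl].
have mm p : `|m' p - m p| <= 2 * r + `|t' - t| * rho D E.
  apply: le_trans (min_dist _ _ _ _) _.
  by have := height_dist D D' E p; rewrite -/r; lra.
have r0 : 0 <= r by exact: rho_ge0.
have c0 : 0 <= `|t' - t| * rho D E by rewrite mulr_ge0 ?rho_ge0.
apply: (@rho_le _ _ (fun p => (potential D D' p + m' p) - m p)).
- by apply: locally_plB => //; apply: locally_plD => //; exact: potential_pl.
- move=> p; rewrite laplacianB//; last first.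
    by apply: locally_plD => //; exact: potential_pl.
  rewrite laplacianD//; last exact: potential_pl.
  rewrite laplacian_potential Fm F'm'.
  by move: (laplacian m p) (laplacian m' p) => x y; ring.
- by lra.
- move=> p q; have := mm p; have := mm q; rewrite !ler_norml.
  by have := potential_sub_le_rho D D' p q; rewrite -/r; lra.
Qed.

End Metric.

(** * The contraction along tropical segments *)

Theorem theorem4p4 (R : realType) (G : metricGraph R) (d : R) (hd : 0 <= d)
    (T : set (effDivisor G d)) (T0 : T !=set0) (hT : tropically_convex T) :
  contractible R T.
Proof.
have [E TE] := T0; exists E => //.
(* [tpath] is only a function on points, so the divisor in [T] with these coefficients is chosen;
   [E] is the default where none exists. *)
pose H (x : R * effDivisor G d) := xget E
  [set F | T F /\ forall p, F p = tpath x.2 E x.1 p].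
have HP t D : 0 <= t <= 1 -> T D ->
    T (H (t, D)) /\ forall p, H (t, D) p = tpath D E t p.
  move=> t01 TD; apply: (@xgetPex _ E [set F | T F /\ forall p, F p = tpath D E t p]).
  (* Tropical convexity shows that such a divisor exists. *)
  have [|F TF FE] := hT D E TD TE (tpath D E t).
    by exists t => //=; rewrite in_itv.
  by exists F; split=> // p; rewrite FE.
exists H; split.
- apply/subspace_continuousP => -[t D] [/=]; rewrite in_itv/= => t01 TD.
  move=> U /nbhs_rhoP[r r0 rU].
  have [_ HE] := HP t D t01 TD.
  have rE := rho_ge0 D E.
  (* Keeps the time term of [tpath_dist] within [2 * (r / 4)]; the added 1 covers [rho D E = 0]. *)
  pose c := r / (4 * (rho D E + 1)).
  have c0 : 0 < c by rewrite divr_gt0// mulr_gt0// ltr_wpDl.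
  (* With this radius the term [5 * rho D D'] stays strictly below [r / 2]. *)
  have r10 : 0 < r / 10 by rewrite divr_gt0.
  rewrite /= /within/=.
  exists (ball t c, [set D' | rho D D' < r / 10]).
    by split=> /=; [exact: nbhsx_ballx|exact: nbhs_rho_ball].
  move=> [t' D'] [/= tt' DD'] [/=]; rewrite in_itv/= => t'01 TD'.
  have [_ HE'] := HP t' D' t'01 TD'.
  apply: rU; apply: le_lt_trans (tpath_dist t'01 HE HE') _.
  have : `|t' - t| * rho D E <= r / 4.
    have /ltW tc : `|t' - t| < c by rewrite distrC.
    apply: le_trans (_ : c * (rho D E + 1) <= _).
      by apply: ler_pM => //; rewrite lerDl.
    rewrite /c le_eqVlt; apply/orP; left; apply/eqP; field.
    by rewrite gt_eqF// ltr_wpDl.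
  by move: DD'; lra.
- by move=> t D t01 TD; exact: (HP t D t01 TD).1.
- move=> D TD; apply: effDivisor_eq => p.
  by rewrite (HP 0 D _ TD).2 ?tpath0// lexx ler01.
- move=> D TD; apply: effDivisor_eq => p.
  by rewrite (HP 1 D _ TD).2 ?tpath1// lexx ler01.
Qed.
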